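(* Let $n \geq 9$ and let $k \in \{1, 2, \dotsc, \lfloor n/2 \rfloor\}$. Then there exists a constant $a_k = \frac{n}{k} + \alpha_k$ with $|\alpha_k| \leq \frac{10}{n}$ such that \[ Q - \mathbbm{1} \;\subset\; P_k - \mathbbm{1} \;\subset\; a_k\,(Q - \mathbbm{1}). \]
   Context: Let $N = n(n-1)/2$ and index the coordinates of $\mathbb{R}^N$ by unordered pairs $\{i,j\}$ of distinct elements of $\{1,\dotsc,n\}$ (write $x_{ij}=x_{ji}$ for the $\{i,j\}$ coordinate). Let $X \subset \mathbb{R}^N$ be the set of incidence vectors of Hamiltonian cycles of the complete graph $K_n$: $x_{ij}=1$ if the cycle contains edge $\{i,j\}$ and $0$ otherwise ($|X| = (n-1)!/2$). Define $Q = \{ f: X \to \mathbb{R} : f \text{ is the restriction to } X \text{ of a linear function on } \mathbb{R}^N,\ f(x)\ge 0 \ \forall x\in X,\ \frac{1}{|X|}\sum_{x\in X} f(x) = 1\}$. For a function $f:X\to\mathbb{R}$, let $q_f$ be the quadratic form on the space $\mathcal{P}_k(\mathbb{R}^N)$ of real polynomials of degree at most $k$ on $\mathbb{R}^N$ given by $q_f(h) = \frac{1}{|X|}\sum_{x\in X} f(x) h(x)^2$. Define $P_k$ as the set of all $f:X\to\mathbb{R}$ that are restrictions to $X$ of linear functions on $\mathbb{R}^N$, have average value $1$ on $X$, and for which $q_f$ is positive semidefinite on $\mathcal{P}_k(\mathbb{R}^N)$. Let $\mathbbm{1}$ denote the constant function $1$ on $X$ (it is the restriction of the linear function $x \mapsto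 \frac1n\sum_{i<j} x_{ij}$). Sets of functions are translated and scaled pointwise: $S - \mathbbm{1} = \{f - \mathbbm{1}: f\in S\}$, $aS = \{af : f \in S\}$. *)

(* Defs.v *)
From HB Require Import structures.
From mathcomp Require Import all_boot all_order all_algebra all_fingroup.
From mathcomp Require Import mpoly.
From mathcomp Require Import reals.
Set Implicit Arguments. Unset Strict Implicit. Unset Printing Implicit Defensive.
Import Order.TTheory GRing.Theory Num.Theory.
Local Open Scope ring_scope.

(* Edges of K_n = coordinates of R^N: unordered pairs {i,j} of distinct vertices. *)
Definition edge (n : nat) : finType := {A : {set 'I_n} | #|A| == 2%N}.

Definition is_ham (n : nat) (H : {set edge n}) : bool :=
  [exists s : 'S_n,
    H == [set e : edge n | [exists i : 'I_n, val e == [set s i; s (ordS i)]]]].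

(* X: the Hamiltonian cycles of K_n (identified with their incidence vectors). *)
Definition hc (n : nat) : finType := {H : {set edge n} | is_ham H}.

Section Defs.
Variables (R : realType) (n : nat).

Definition inc (x : hc n) (e : edge n) : R := (e \in val x)%:R.

Definition coord (x : hc n) : 'I_#|edge n| -> R := fun i => inc x (enum_val i).

Definition avg (f : hc n -> R) : R := (#|hc n|%:R)^-1 * \sum_x f x.

Definition is_lin (f : hc n -> R) : Prop :=
  exists c : edge n -> R, forall x, f x = \sum_e c e * inc x e.

Definition Qset (f : hc n -> R) : Prop :=
  [/\ is_lin f, forall x, 0 <= f x & avg f = 1].

Definition qf (f : hc n -> R) (h : {mpoly R[#|edge n|]}) : R :=
  avg (fun x => f x * (h.@[coord x]) ^+ 2).

(* P_k: q_f positive semidefinite on polynomials of degree <= k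
   (msize h = 1 + total degree, or 0 for h = 0) *)
Definition Pset (k : nat) (f : hc n -> R) : Prop :=
  [/\ is_lin f, avg f = 1 &
      forall h : {mpoly R[#|edge n|]}, (msize h <= k.+1)%N -> 0 <= qf f h].

Definition one_fn : hc n -> R := fun _ => 1.

Definition shiftS (S : (hc n -> R) -> Prop) (c : hc n -> R) : (hc n -> R) -> Prop :=
  fun g => exists2 f, S f & g = (fun x => f x - c x).
Definition scaleS (a : R) (S : (hc n -> R) -> Prop) : (hc n -> R) -> Prop :=
  fun g => exists2 f, S f & g = (fun x => a * f x).
Definition subsetS (S T : (hc n -> R) -> Prop) : Prop := forall g, S g -> T g.

End Defs.

(* Main.v *)
Require Import Defs.
From HB Require Import structures.
From mathcomp Require Import all_boot all_order all_algebra all_fingroup.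
From mathcomp Require Import mpoly.
From mathcomp Require Import reals boolp.
From mathcomp Require Import zify ring lra.
Set Implicit Arguments. Unset Strict Implicit. Unset Printing Implicit Defensive.
Import Order.TTheory GRing.Theory Num.Theory.
Local Open Scope ring_scope.

(* If f lies in P_k, it suffices to bound f(x0) from below by 1 - n/k - 10/n at
   every Hamiltonian cycle x0; then a_k = n/k + 10/n works.  Fix a matching of
   floor(n/2) edges of x0 and k of its edges.  The product of the corresponding k
   coordinates is a 0/1-valued polynomial h of degree k, so q_f(h) >= 0 says that
   f has nonnegative mean on the cycles through these k edges.  Averaging this
   over the automorphisms of the matching and over the rotations of x0 turns the
   mean of x into a combination of x0 and the all-ones vector, on which f has the
   value (n-1)/2.  The coefficients follow from the degree equations and one
   estimate: among the cycles through k disjoint edges, a proportion of at least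
   2/(n-k-1) passes through a further disjoint edge.

   Cycles are handled as permutations s of Z/n, the cycle being
   s 0, s 1, ..., s (n-1); each cycle arises from the same number of s. *)

Section Cycles.
Variable m : nat.
Local Notation n := m.+2.
Implicit Types (s g h : 'S_n) (i j p q : 'I_n).

Lemma ordSE p : ordS p = p + 1.
Proof. by rewrite (@add_Zp_1 n p). Qed.

Lemma val_add1 p : p + 1 = (if p.+1 == n then 0 else p.+1) :> nat.
Proof.
rewrite -ordSE /=; case: eqP => [->|h]; first by rewrite modnn.
by rewrite modn_small //; have := ltn_ord p; lia.
Qed.

Lemma ord_eqE p q : (p == q) = (p == q :> nat).
Proof. by []. Qed.

Definition adj s i j : bool :=
  ((s^-1)%g j == (s^-1)%g i + 1) || ((s^-1)%g i == (s^-1)%g j + 1).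

Lemma adjC s i j : adj s i j = adj s j i.
Proof. by rewrite /adj orbC. Qed.

Lemma adjE s p q : adj s (s p) (s q) = (q == p + 1) || (p == q + 1).
Proof. by rewrite /adj !permK. Qed.

Lemma adjM s g i j : adj (s * g)%g (g i) (g j) = adj s i j.
Proof. by rewrite /adj invMg !permM !permK. Qed.

Lemma adj_reindex (r s : 'S_n) :
  (forall p q, ((r q == r p + 1) || (r p == r q + 1)) =
               ((q == p + 1) || (p == q + 1))) ->
  adj (r * s)%g =2 adj s.
Proof.
move=> hr i j; rewrite -(permKV (r * s)%g i) -(permKV (r * s)%g j).
by rewrite adjE !permM adjE hr.
Qed.

Definition rot_perm (t : 'I_n) : 'S_n := perm (addIr t).
Definition opp_perm : 'S_n := perm (@oppr_inj 'I_n).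

Lemma adj_rot t s : adj (rot_perm t * s)%g =2 adj s.
Proof.
apply: adj_reindex => p q; rewrite !permE.
by rewrite ![_ + t + 1]addrAC !(inj_eq (addIr _)).
Qed.

Lemma adj_opp s : adj (opp_perm * s)%g =2 adj s.
Proof.
have E p q : (- q == - p + 1 :> 'I_n) = (p == q + 1).
  by rewrite -(inj_eq oppr_inj) opprK opprD opprK eq_sym subr_eq.
by apply: adj_reindex => p q; rewrite !permE !E orbC.
Qed.

Definition rev_fun j p : 'I_n := if (0 < p <= j)%N then inord (j.+1 - p) else p.

Lemma val_rev_fun j p :
  rev_fun j p = (if 0 < p <= j then j.+1 - p else p)%N :> nat.
Proof.
rewrite /rev_fun; case: ifP => // hp.
by rewrite inordK //; have := ltn_ord j; lia.
Qed.

Lemma rev_funK j : involutive (rev_fun j).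
Proof.
move=> p; apply: val_inj => /=; rewrite !val_rev_fun.
by have [hp|hp] := boolP (0 < p <= j)%N; case: ifP; lia.
Qed.

Definition rev_perm j : 'S_n := perm (inv_inj (rev_funK j)).

Lemma adj_rev_perm j s i1 i2 :
  i1 != s 0 -> i2 != s 0 -> i1 != s j -> i2 != s j ->
  adj s i1 i2 -> adj (rev_perm j * s)%g i1 i2.
Proof.
wlog: i1 i2 / (s^-1)%g i2 == (s^-1)%g i1 + 1.
  move=> hw h1 h2 h3 h4 h; have := h; rewrite {1}/adj => /orP[e|e].
    exact: hw.
  by rewrite adjC; apply: hw => //; rewrite adjC.
rewrite -(permKV s i1) -(permKV s i2) !permK.
move: ((s^-1)%g i1) ((s^-1)%g i2) => p q /eqP eq h1 h2 h3 h4 _.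
have E x : s x = (rev_perm j * s)%g (rev_fun j x) by rewrite permM permE rev_funK.
rewrite !E adjE.
move: h1 h2 h3 h4; rewrite !(inj_eq (@perm_inj _ s)) !ord_eqE !val_add1 !val_rev_fun /= => h1 h2 h3 h4.
have : q = p.+1 :> nat.
  by have := val_add1 p; rewrite -eq; case: eqP => // _ e; rewrite e eqxx in h2.
move=> e.
have hq := ltn_ord q; have hp := ltn_ord p; have hj := ltn_ord j.
rewrite e in h2 h4 hq *.
have -> : (0 < p <= j)%N = (p < j)%N by lia.
have -> : (0 < p.+1 <= j)%N = (p < j)%N by lia.
by case: (boolP (p < j)%N) => h; do 2![case: ifP => ?]; lia.
Qed.

End Cycles.

Section Pairing.
Variable m : nat.
Local Notation n := m.+2.
Implicit Types (s g h : 'S_n) (i j p q u w : 'I_n).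

(* Pairs 2t with 2t+1; the last vertex is its own mate when n is odd. *)
Definition mate i : 'I_n :=
  if odd i then inord i.-1 else if (i.+1 < n)%N then inord i.+1 else i.

Lemma val_mate i :
  mate i = (if odd i then i.-1 else if i.+1 < n then i.+1 else i)%N :> nat.
Proof.
have := ltn_ord i; rewrite /mate; case: ifP => _; first by move=> ?; rewrite inordK //; lia.
by case: ifP => // ? _; rewrite inordK.
Qed.

Lemma mateK : involutive mate.
Proof.
move=> i; apply: val_inj => /=; rewrite !val_mate.
have := ltn_ord i.
by case: (boolP (odd i)) => h1; [|case: (boolP (i.+1 < n)%N) => h2]; repeat case: ifP => ?; lia.
Qed.

Definition mate_perm : 'S_n := perm (inv_inj mateK).

Lemma mate_fixE i : (mate i == i) = odd n && (i == n.-1 :> nat).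
Proof.
have := ltn_ord i; rewrite ord_eqE val_mate.
by case: (boolP (odd i)) => hi; [|case: (boolP (i.+1 < n)%N)]; lia.
Qed.

Lemma mate_eqC i j : (mate i == j) = (i == mate j).
Proof. exact: (can2_eq mateK mateK). Qed.

Lemma sum_fix : (\sum_i (mate i == i) = odd n)%N.
Proof.
under eq_bigr => i _ do rewrite mate_fixE.
have [o|o] := boolP (odd n); last by rewrite big1.
rewrite (bigD1 ord_max) //= eqxx big1 // => i.
by rewrite ord_eqE /= => /negbTE ->.
Qed.

Variable k : nat.
Hypotheses (m_gt0 : (0 < m)%N) (k2n : (k.*2 <= n)%N).

Lemma mate_lt i : (mate i < k.*2)%N = (i < k.*2)%N.
Proof.
have := ltn_ord i; rewrite val_mate; repeat case: ifP => ?; lia.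
Qed.

Lemma mate_neq i : (i < k.*2)%N -> mate i != i.
Proof.
rewrite ord_eqE val_mate.
have := ltn_ord i; repeat case: ifP => ?; lia.
Qed.

Definition sat s : bool := [forall i : 'I_n, (i < k.*2)%N ==> adj s i (mate i)].

Lemma sat_adj_eq s s' : adj s =2 adj s' -> sat s = sat s'.
Proof. by move=> e; apply: eq_forallb => i; rewrite e. Qed.

Lemma sat1 : sat 1%g.
Proof.
apply/forallP => i; apply/implyP => hi.
rewrite -[X in adj _ X _](perm1 i) -[X in adj _ _ X](perm1 (mate i)) adjE.
rewrite !ord_eqE !val_add1 val_mate.
have := ltn_ord i.
by case: (boolP (odd i)) => h1; repeat case: ifP => ?; lia.
Qed.

Definition pinned u y : {set 'S_n} := [set s : 'S_n | [&& s 0 == u, s 1 == y & sat s]].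

(* In u, i, mate i, ..., w, ... reverse the segment from i to w: w becomes the
   successor of u, and the length of the segment is recovered as the last of the
   two positions of i and mate i, so the map is injective. *)
Lemma pinned_pair u w i : (k.*2 <= u)%N -> (k.*2 <= w)%N -> w != u -> (i < k.*2)%N ->
  (#|pinned u i| + #|pinned u (mate i)| <= #|pinned u w|)%N.
Proof.
move=> hu hw wu hi.
pose D := pinned u i :|: pinned u (mate i).
have -> : (#|pinned u i| + #|pinned u (mate i)| = #|D|)%N.
  apply/esym/eqP; rewrite (leq_card_setU (pinned u i) (pinned u (mate i))).2.
  rewrite -setI_eq0; apply/eqP/setP => s; rewrite !inE.
  apply/negP => /andP[/and3P[_ /eqP -> _] /and3P[_ /eqP e _]].
  by have := mate_neq hi; rewrite -e eqxx.
pose F (s : 'S_n) := (rev_perm ((s^-1)%g w) * s)%g.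
have DP s : s \in D ->
   [/\ s 0 = u, sat s, [\/ s 1 = i /\ s (1 + 1) = mate i | s 1 = mate i /\ s (1 + 1) = i]
     & (2 < (s^-1)%g w)%N].
  rewrite !inE => h.
  have {h}[s0 ss s1] : [/\ s 0 = u, sat s & s 1 = i \/ s 1 = mate i].
    by case/orP: h => /and3P[/eqP ? /eqP ? ?]; split => //; [left|right].
  have key (a : 'I_n) : (a < k.*2)%N -> s 1 = a -> s (1 + 1) = mate a.
    move=> ha e; have /forallP/(_ a)/implyP/(_ ha) := ss.
    rewrite -{1}e -{1}(permKV s (mate a)) adjE => /orP[/eqP <-|/eqP e1].
      by rewrite permKV.
    have : mate a = u.
      rewrite -s0 -(permKV s (mate a)); congr (s _); apply: (addIr 1).
      by rewrite add0r -e1.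
    by move=> e2; move: ha; rewrite -mate_lt e2; lia.
  have s12 : [\/ s 1 = i /\ s (1 + 1) = mate i | s 1 = mate i /\ s (1 + 1) = i].
    case: s1 => e; [left|right]; split=> //; first exact: key.
    by rewrite (key _ _ e) ?mateK ?mate_lt.
  split => //.
  have hmi : (mate i < k.*2)%N by rewrite mate_lt.
  have n0 : s 0 != w by rewrite s0 eq_sym.
  have n1 : s 1 != w by case: s12 => -[-> _]; apply/eqP => e; rewrite -e in hw; lia.
  have n2 : s (1 + 1) != w by case: s12 => -[_ ->]; apply/eqP => e; rewrite -e in hw; lia.
  move: n0 n1 n2; rewrite -(permKV s w) !(inj_eq (@perm_inj _ s)) !ord_eqE permK val_add1 /=.
  by rewrite modn_small // => ? ?; case: ifP => [/eqP|_]; lia.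
have v2 : (1 + 1 : 'I_n) = 2%N :> nat.
  by rewrite val_add1 /= modn_small //; case: eqP => //; lia.
have posF s : s \in D -> maxn ((F s)^-1%g i) ((F s)^-1%g (mate i)) = (s^-1)%g w.
  case/DP => _ _ s12 j3.
  have E p : (F s)^-1%g (s p) = rev_fun ((s^-1)%g w) p.
    by apply: (@perm_inj _ (F s)); rewrite permKV /F permM permE rev_funK.
  have h1 : rev_fun ((s^-1)%g w) 1 = ((s^-1)%g w) :> nat.
    by rewrite val_rev_fun /= modn_small //; case: ifP => //; lia.
  have h2 : rev_fun ((s^-1)%g w) (1 + 1) = ((s^-1)%g w).-1 :> nat.
    by rewrite val_rev_fun v2; case: ifP => //; lia.
  by case: s12 => -[<- <-]; rewrite !E h1 h2; lia.
have Finj : {in D &, injective F}.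
  move=> s s' hs hs' e.
  have := posF _ hs; rewrite e posF // => /val_inj e1.
  by move: e; rewrite /F e1; apply: mulgI.
rewrite -(card_in_imset Finj); apply/subset_leq_card/subsetP => _ /imsetP[s hs ->].
have [s0 ss s12 j3] := DP _ hs.
rewrite inE /F !permM ![rev_perm _ _]permE; apply/and3P; split.
- by rewrite /rev_fun /= s0.
- suff -> : rev_fun ((s^-1)%g w) 1 = (s^-1)%g w by rewrite permKV.
  by apply: val_inj; rewrite /= val_rev_fun /= modn_small //; case: ifP => //; lia.
apply/forallP => a; apply/implyP => ha.
have ma : (mate a < k.*2)%N by rewrite mate_lt.
apply: adj_rev_perm; rewrite ?s0 ?permKV ?ord_eqE; try lia.
by move/forallP/(_ a)/implyP: ss; apply.
Qed.

End Pairing.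

Section Counting.
Variables (m k : nat).
Local Notation n := m.+2.
Implicit Types (s g h : 'S_n) (i j p q u w y : 'I_n).
Hypotheses (m_gt0 : (0 < m)%N) (k2n : (k.*2 <= n)%N).
Local Notation sat := (@sat m k).
Local Notation pinned := (@pinned m k).

Definition num_sat : nat := (\sum_(s : 'S_n) sat s)%N.
Definition num_sat_adj i j : nat := (\sum_(s : 'S_n) (sat s && adj s i j))%N.

Lemma sum_pinned_rot (F : 'S_n -> nat) u :
  (forall t s, F (rot_perm t * s)%g = F s) ->
  (\sum_s F s = n * \sum_(s : 'S_n | s 0%R == u) F s)%N.
Proof.
move=> Frot; rewrite (partition_big (fun s => (s^-1)%g u) predT) //=.
rewrite (eq_bigr (fun=> \sum_(s : 'S_n | s 0%R == u) F s)%N); last first.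
  move=> t _; rewrite [RHS](reindex_inj (mulgI (rot_perm t))) /=.
  apply: eq_big => [s|s _]; last by rewrite Frot.
  by rewrite permM [rot_perm t _]permE add0r (canF_eq (permKV s)) eq_sym.
by rewrite sum_nat_const card_ord.
Qed.

Lemma num_sat_pinned u : num_sat = (n * \sum_y #|pinned u y|)%N.
Proof.
rewrite /num_sat (sum_pinned_rot u); last first.
  by move=> t s; rewrite (sat_adj_eq k (adj_rot t s)).
congr (_ * _)%N; rewrite (partition_big (fun s : 'S_n => s 1%R) predT) //=.
apply: eq_bigr => y _; rewrite -sum1_card big_mkcond /= [RHS]big_mkcond /=.
by apply: eq_bigr => s _; rewrite inE; case: (s 0%R == u) => //=; case: (s 1%R == y); case: (sat s).
Qed.

Lemma num_sat_adj_pinned u w : u != w ->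
  num_sat_adj u w = (n * (#|pinned u w| + #|pinned u w|))%N.
Proof.
move=> uw.
rewrite /num_sat_adj (sum_pinned_rot u); last first.
  by move=> t s; rewrite (sat_adj_eq k (adj_rot t s)) adj_rot.
congr (_ * _)%N.
have E1 : #|pinned u w| = (\sum_(s : 'S_n | s 0%R == u) (sat s && (s 1%R == w)))%N.
  rewrite -sum1_card big_mkcond /= [RHS]big_mkcond /=.
  by apply: eq_bigr => s _; rewrite inE; case: (_ == _) => //=; case: (_ == _); case: (sat s).
have E2 : #|pinned u w| = (\sum_(s : 'S_n | s 0%R == u) (sat s && (s (- 1)%R == w)))%N.
  rewrite E1 (reindex_inj (mulgI (opp_perm m))) /=.
  apply: eq_big => [s|s _]; first by rewrite permM permE oppr0.
  by rewrite (sat_adj_eq k (adj_opp s)) permM permE.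
rewrite {1}E1 E2 -big_split /=; apply: eq_bigr => s /eqP s0.
rewrite /adj.
have -> : (s^-1)%g u = 0 by rewrite -s0 permK.
rewrite add0r (canF_eq (permKV s)) [w == s 1%R]eq_sym.
have -> : (0 == (s^-1)%g w + 1) = (s (-1) == w).
  by rewrite eq_sym addr_eq0 (canF_eq (permKV s)) eq_sym.
case: (sat s) => //=; case: eqP => e1; case: eqP => e2 //=.
have : (1 : 'I_n) = -1 by apply: (@perm_inj _ s); rewrite e1.
move/eqP; rewrite -addr_eq0 ord_eqE val_add1 /= modn_small //.
by case: ifP => //; lia.
Qed.

Lemma pinned_fresh_le u w y : (k.*2 <= w)%N -> (k.*2 <= y)%N -> w != u -> y != u ->
  (#|pinned u y| <= #|pinned u w|)%N.
Proof.
move=> hw hy wu yu.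
rewrite -(card_imset _ (mulIg (tperm w y))).
apply/subset_leq_card/subsetP => _ /imsetP[s + ->].
rewrite !inE !permM => /and3P[/eqP-> /eqP-> ss].
rewrite tpermR tpermD // !eqxx /=.
apply/forallP => i; apply/implyP => hi.
have hmi : (mate i < k.*2)%N by rewrite mate_lt.
have /forallP/(_ i)/implyP/(_ hi) := ss.
rewrite -(adjM _ (tperm w y)) !tpermD // ord_eqE; lia.
Qed.

(* Summing [pinned_pair] over the k pairs, the 2k matched successors of u together
   weigh at most as much as k unmatched ones. *)
Lemma fresh_pair u w : (k.*2 <= u)%N -> (k.*2 <= w)%N -> w != u ->
  (2 * num_sat <= (n - k - 1) * num_sat_adj u w)%N.
Proof.
move=> hu hw wu.
rewrite (num_sat_pinned u) num_sat_adj_pinned 1?eq_sym //.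
set p := #|pinned u w|.
suff : (\sum_y #|pinned u y| <= (n - k - 1) * p)%N by nia.
rewrite (bigID (fun y : 'I_n => (y < k.*2)%N)) /=.
have c1 : #|[pred y : 'I_n | (y < k.*2)%N]| = k.*2.
  by rewrite -sum1_card -(big_ord_widen n (fun=> 1%N) k2n) sum1_card card_ord.
have h1 : (\sum_(y : 'I_n | (y < k.*2)%N) #|pinned u y| <= k * p)%N.
  have E : (\sum_(y : 'I_n | (y < k.*2)%N) #|pinned u y|
            = \sum_(y : 'I_n | (y < k.*2)%N) #|pinned u (mate y)|)%N.
    rewrite (reindex_inj (inv_inj (@mateK m))); apply: eq_bigl => y.
    by rewrite mate_lt.
  suff : (\sum_(y : 'I_n | (y < k.*2)%N) #|pinned u y|
          + \sum_(y : 'I_n | (y < k.*2)%N) #|pinned u (mate y)| <= k.*2 * p)%N.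
    rewrite -E; lia.
  rewrite -big_split /= -{2}c1 -sum_nat_const.
  by apply: leq_sum => y hy; apply: pinned_pair.
have h2 : (\sum_(y : 'I_n | ~~ (y < k.*2)%N) #|pinned u y| <= (n - k.*2 - 1) * p)%N.
  rewrite (bigD1 u) /=; last by rewrite -leqNgt.
  have -> : #|pinned u u| = 0%N.
    apply/eqP; rewrite cards_eq0; apply/eqP/setP => s; rewrite !inE.
    apply/negP => /and3P[/eqP e1 /eqP e2 _].
    by have /perm_inj/eqP := etrans e1 (esym e2).
  rewrite add0n.
  have -> : (n - k.*2 - 1 = #|[pred y : 'I_n | ~~ (y < k.*2)%N && (y != u)]|)%N.
    have := cardC [pred y : 'I_n | (y < k.*2)%N]; rewrite c1 card_ord => e.
    have := cardD1 u [predC [pred y : 'I_n | (y < k.*2)%N]].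
    rewrite !inE -leqNgt hu /= => e'.
    have -> : (n - k.*2 = #|[predC [pred y : 'I_n | (y < k.*2)%N]]|)%N by rewrite -[X in (X - _)%N]e addKn.
    rewrite e' addKn; apply: eq_card => y; rewrite !inE andbC //.
  rewrite -sum_nat_const; apply: leq_sum => y /andP[hy yu].
  by apply: pinned_fresh_le; rewrite // leqNgt.
apply: leq_trans (leq_add h1 h2) _; rewrite -mulnDl leq_mul2r.
have := ltn_ord u; have := ltn_ord w; move: wu; rewrite ord_eqE; lia.
Qed.

End Counting.

Section AdjSums.
Variable m : nat.
Local Notation n := m.+2.
Implicit Types (s g h : 'S_n) (i j p q u w y : 'I_n).

Lemma add1_neq p : p == p + 1 = false.
Proof. by rewrite eq_sym -subr_eq0 addrAC subrr add0r ord_eqE /= modn_small. Qed.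

Lemma adj_irrefl s i : adj s i i = false.
Proof. by rewrite /adj orbb add1_neq. Qed.

Hypothesis m_gt0 : (0 < m)%N.

Lemma add1_asym p q : ~~ ((q == p + 1) && (p == q + 1)).
Proof.
apply/negP => /andP[/eqP -> /eqP /esym/eqP].
rewrite -addrA -subr_eq0 addrAC subrr add0r ord_eqE val_add1 /= modn_small //.
by case: ifP => //; lia.
Qed.

Lemma sum_adj (T : nmodType) s (F : 'I_n -> 'I_n -> T) :
  \sum_i \sum_j (F i j) *+ adj s i j
    = \sum_p (F (s p) (s (p + 1)) + F (s (p + 1)) (s p)).
Proof.
rewrite (reindex_inj (@perm_inj _ s)) /=.
under eq_bigr => p _.
  rewrite (reindex_inj (@perm_inj _ s)) /=.
  under eq_bigr => q _.
    rewrite adjE.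
    have -> : F (s p) (s q) *+ ((q == p + 1) || (p == q + 1)) =
      F (s p) (s q) *+ (q == p + 1) + F (s p) (s q) *+ (p == q + 1).
      have := add1_asym p q.
      by case: (q == p + 1); case: (p == q + 1); rewrite //= ?mulr0n ?addr0 ?add0r.
    over.
  rewrite big_split /=.
  over.
rewrite big_split /= [X in _ + X]exchange_big -big_split /=; apply: eq_bigr => p _.
have E (G : 'I_n -> T) : \sum_i G i *+ (i == p + 1) = G (p + 1).
  rewrite (bigD1 (p + 1)) //= eqxx big1 ?addr0 // => i /negbTE ->.
  by rewrite mulr0n.
by rewrite (E (fun q => F (s p) (s q))) (E (fun q => F (s q) (s p))).
Qed.

Lemma sum_adj_row s i : (\sum_j adj s i j = 2)%N.
Proof.
rewrite (reindex_inj (@perm_inj _ s)) /= -(permKV s i).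
set p := (s^-1)%g i.
under eq_bigr => q _.
  rewrite adjE.
  have -> : nat_of_bool ((q == p + 1) || (p == q + 1))%R =
      ((q == p + 1)%R + (q == p - 1)%R)%N.
    rewrite [q == p - 1]eq_sym subr_eq; have := add1_asym p q.
    by case: (q == p + 1); case: (p == q + 1).
  over.
rewrite big_split /=.
have E x : (\sum_(i < n) (i == x) = 1)%N.
  by rewrite (bigD1 x) //= eqxx big1 // => y /negbTE ->.
by rewrite !E.
Qed.

End AdjSums.

Section Averaging.
Variables (m k : nat).
Local Notation n := m.+2.
Implicit Types (s g h : 'S_n) (i j p q u w y : 'I_n).
Hypotheses (m_gt3 : (3 < m)%N) (k2n : (k.*2 <= n)%N).
Local Notation sat := (@sat m k).
Local Notation num_sat := (@num_sat m k).
Local Notation num_sat_adj := (@num_sat_adj m k).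
Local Notation mate := (@mate m).

Let m_gt0 : (0 < m)%N. Proof. lia. Qed.

Definition mate_cent : {set 'S_n} := 'C[@mate_perm m]%g.
Definition num_total : nat := (#|mate_cent| * num_sat)%N.
(* Up to normalisation, the expectation of x_ij over the cycles through a random
   image of the k pairs under the centraliser of [mate_perm]. *)
Definition wgt i j : nat := (\sum_(h in mate_cent) num_sat_adj (h i) (h j))%N.

Lemma mate_centP g : reflect (forall i, g (mate i) = mate (g i)) (g \in mate_cent).
Proof.
apply: (iffP cent1P) => [e i|e].
  by have := congr1 (fun x : 'S_n => x i) e; rewrite !permM !permE.
by apply/permP => i; rewrite !permM !permE e.
Qed.

Lemma num_sat_gt0 : (0 < num_sat)%N.
Proof. by rewrite /num_sat (bigD1 1%g) //= sat1. Qed.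

Lemma num_total_gt0 : (0 < num_total)%N.
Proof. by rewrite muln_gt0 num_sat_gt0 cardG_gt0. Qed.

Lemma num_sat_adjC i j : num_sat_adj i j = num_sat_adj j i.
Proof. by apply: eq_bigr => s _; rewrite adjC. Qed.

Lemma wgtC i j : wgt i j = wgt j i.
Proof. by apply: eq_bigr => s _; rewrite num_sat_adjC. Qed.

Lemma num_sat_adj_row i : (\sum_j num_sat_adj i j = 2 * num_sat)%N.
Proof.
rewrite exchange_big big_distrr /=; apply: eq_bigr => s _.
by case: (sat s) => /=; rewrite ?sum_adj_row // big1.
Qed.

Lemma wgt_row i : (\sum_j wgt i j = 2 * num_total)%N.
Proof.
rewrite exchange_big /= (eq_bigr (fun=> 2 * num_sat)%N).
  by rewrite sum_nat_const mulnCA.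
move=> h _; rewrite -(num_sat_adj_row (h i)).
by rewrite [RHS](reindex_inj (@perm_inj _ h)).
Qed.

Lemma wgt_diag i : wgt i i = 0%N.
Proof.
by apply: big1 => h _; apply: big1 => s _; rewrite adj_irrefl andbF.
Qed.

Lemma wgt_inv g i j : g \in mate_cent -> wgt (g i) (g j) = wgt i j.
Proof.
move=> hg; rewrite /wgt [RHS](reindex_inj (mulgI g)) /=.
by apply: eq_big => [h|h _]; rewrite ?groupMl // !permM.
Qed.

Lemma mate_swap i j : mate i != i -> mate j != j ->
  exists2 g, g \in mate_cent &
    g i = j /\ forall x, x != i -> x != mate i -> x != j -> x != mate j -> g x = x.
Proof.
move=> fi fj; have [<-|ij] := eqVneq i j.
  by exists 1%g; [exact: group1 | split => [|x *]; rewrite perm1].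
have mK := @mateK m.
have [e|mij] := eqVneq (mate i) j.
  exists (tperm i j); last first.
    by split=> [|x xi _ xj _]; rewrite ?tpermL // tpermD // eq_sym.
  apply/mate_centP => x; case: tpermP => [ex|ex|xi xj].
  - by rewrite -[x]mK ex -e tpermR.
  - by rewrite -[x]mK ex -e mK tpermL mK.
  - by rewrite tpermD //; apply/eqP => ex; [apply: xj | apply: xi]; rewrite -ex -e ?mK.
have mji : mate j != i by rewrite (can2_eq mK mK) eq_sym.
have mm : mate i != mate j by rewrite (inj_eq (inv_inj mK)).
exists (tperm i j * tperm (mate i) (mate j))%g; last first.
  split=> [|x *]; rewrite permM ?tpermL ?tpermD // 1?eq_sym //.
apply/mate_centP => x; rewrite !permM.
have T y : (tperm (mate i) (mate j)) (mate y) = mate (tperm i j y).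
  case: (tpermP i j y) => [->|->|yi yj]; rewrite ?tpermL ?tpermR //.
  by rewrite tpermD // (inj_eq (inv_inj mK)) eq_sym; apply/eqP.
have T' y : tperm i j (mate y) = mate (tperm (mate i) (mate j) y).
  by rewrite -{2}[y]mK T !mK.
rewrite T' T -!permM; congr (mate (_ x)).
by rewrite conjgC tpermJ !tpermD // 1?eq_sym // (can2_eq mK mK) mK eq_sym.
Qed.

Lemma wgt_mate i j : mate i != i -> mate j != j -> wgt i (mate i) = wgt j (mate j).
Proof.
move=> hi hj; have [g hg [gi _]] := mate_swap hi hj.
by rewrite -(wgt_inv _ _ hg) (mate_centP _ hg) gi.
Qed.

Lemma wgt_move i j j' : mate j != j -> mate j' != j' ->
  j != i -> j != mate i -> j' != i -> j' != mate i -> wgt i j = wgt i j'.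
Proof.
move=> fj fj' h1 h2 h3 h4; have [g hg [gj gx]] := mate_swap fj fj'.
by rewrite -(wgt_inv _ _ hg) gj gx // eq_sym // mate_eqC.
Qed.

Lemma wgt_far i j i' j' :
  mate i != i -> mate j != j -> j != i -> j != mate i ->
  mate i' != i' -> mate j' != j' -> j' != i' -> j' != mate i' ->
  wgt i j = wgt i' j'.
Proof.
move=> fi fj h1 h2 fi' fj' h1' h2'.
(* A vertex of a third pair lets us replace i and j one at a time. *)
have [l [fl l1 l2 l3 l4]] :
    exists l, [/\ mate l != l, l != i, l != mate i, l != i' & l != mate i'].
  pose S := [:: i; mate i; i'; mate i'; ord_max].
  case: (pickP [pred l | l \notin S]) => [l|hS]; last first.
    have := card_size S; rewrite (eq_card (_ : mem S =i 'I_n)) ?card_ord /=; first by lia.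
    by move=> x; have := hS x; rewrite /= => /negbFE ->.
  rewrite /= !inE !negb_or => /and5P[h3 h4 h5 h6 h7]; exists l; split=> //.
  by move: h7; rewrite mate_fixE ord_eqE /= => /negbTE ->; rewrite andbF.
have E x y : (x != mate y) = (y != mate x) by rewrite -mate_eqC eq_sym.
rewrite (wgt_move fj fl) // wgtC (wgt_move fi fi') 1?E 1?[_ == l]eq_sym //.
by rewrite wgtC; apply: wgt_move; rewrite // E.
Qed.

Lemma wgt_fix i j j' : mate i == i -> j != i -> j' != i -> wgt i j = wgt i j'.
Proof.
move=> fi ji j'i; have mi := eqP fi.
have nf x : x != i -> mate x != x.
  by move: fi; rewrite !mate_fixE ord_eqE; lia.
by apply: wgt_move; rewrite ?nf ?mi.
Qed.

Lemma sum_wgt_mate_ge :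
  (num_total * (k.*2 * (n - k - 1) + 2 * (n - odd n - k.*2))
    <= (n - k - 1) * \sum_i wgt i (mate i))%N.
Proof.
have -> : (\sum_i wgt i (mate i) = #|mate_cent| * \sum_i num_sat_adj i (mate i))%N.
  rewrite exchange_big /= -sum_nat_const; apply: eq_bigr => h hh.
  rewrite [RHS](reindex_inj (@perm_inj _ h)); apply: eq_bigr => i _.
  by rewrite (mate_centP _ hh).
rewrite mulnCA -mulnA leq_mul2l; apply/orP; right.
have c1 : (\sum_(i < n) (i < k.*2) = k.*2)%N.
  rewrite -[RHS]card_ord -sum1_card (big_ord_widen n (fun=> 1%N) k2n) [RHS]big_mkcond.
  by apply: eq_bigr => i _; case: (_ < _)%N.
have c2 : (\sum_(i < n) (~~ (i < k.*2) && (mate i != i)) = n - odd n - k.*2)%N.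
  suff : (\sum_(i < n) (i < k.*2) + \sum_(i < n) (~~ (i < k.*2) && (mate i != i))
          + \sum_(i < n) (mate i == i) = n)%N by rewrite c1 sum_fix; lia.
  rewrite -!big_split /= -[RHS]card_ord -sum1_card; apply: eq_bigr => i _.
  have := @mate_neq m k m_gt0 k2n i.
  by case: (i < k.*2)%N => [/(_ isT) /negbTE ->|] //=; case: (mate i == i).
rewrite -c2 -[X in (X * (n - k - 1))%N]c1 mulnC big_distrl /= [(2 * _)%N]mulnC big_distrl /= -big_split /=.
rewrite big_distrl big_distrr; apply: leq_sum => i _ /=.
have [hi|hi] /= := boolP (i < k.*2)%N.
  rewrite mul1n mul0n addn0 leq_mul2l; apply/orP; right.
  rewrite leq_eqVlt; apply/orP; left; apply/eqP/eq_bigr => s _.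
  have [/forallP/(_ i)/implyP/(_ hi) -> |] := boolP (sat s) => //.
have [fi|fi] := eqVneq (mate i) i; first by rewrite mul0n.
by rewrite mul0n mul1n fresh_pair // leqNgt // mate_lt.
Qed.

End Averaging.

Section Decomposition.
Variables (R : realFieldType) (m k : nat).
Local Notation n := m.+2.
Implicit Types (s g h : 'S_n) (i j p q u w y : 'I_n).
Hypotheses (m_gt3 : (3 < m)%N) (k2n : (k.*2 <= n)%N).
Local Notation mate := (@mate m).
Local Notation wgt := (@wgt m k).
Local Notation num_total := (@num_total m k).

Lemma sum_eq_ind (a : 'I_n) : \sum_i (i == a)%:R = 1 :> R.
Proof. by rewrite (bigD1 a) //= eqxx big1 ?addr0 // => i /negbTE ->. Qed.

(* A, B and C are the weights of a mated pair, of a pair in general position and of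
   a pair containing the vertex without mate. *)
Lemma wgt_decomp : exists A B C : R,
  [/\ forall i j, i != j -> (wgt i j)%:R =
        B + (A - B) * (j == mate i)%:R
          + (C - B) * ((mate i == i)%:R + (mate j == j)%:R),
      n%:R * B - B + (A - B) + (C - B) * (odd n)%:R = 2 * num_total%:R,
      odd n -> (n%:R - 1) * C = 2 * num_total%:R &
      (num_total * (k.*2 * (n - k - 1) + 2 * (n - odd n - k.*2)))%:R
        <= (n - k - 1)%:R * ((n%:R - (odd n)%:R) * A)].
Proof.
have f0 : mate 0 != 0 by rewrite mate_fixE /= andbF.
have hm0 : mate 0 = 1 by apply: val_inj; rewrite /= val_mate /= modn_small.
have hm2 : (inord 2 : 'I_n) = 2%N :> nat by rewrite inordK //; lia.
have f2 : mate (inord 2) != inord 2 by rewrite mate_fixE hm2 /=; lia.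
have n20 : (inord 2 : 'I_n) != 0 by rewrite ord_eqE hm2.
have n21 : (inord 2 : 'I_n) != mate 0 by rewrite hm0 ord_eqE hm2.
exists (wgt 0 (mate 0))%:R, (wgt 0 (inord 2))%:R, (wgt ord_max 0)%:R.
set A := (wgt 0 (mate 0))%:R; set B := (wgt 0 (inord 2))%:R; set C := (wgt ord_max 0)%:R.
have fixmax i : mate i == i -> i = ord_max.
  by rewrite mate_fixE => /andP[_ /eqP e]; apply: val_inj.
have form i j : i != j -> (wgt i j)%:R =
        B + (A - B) * (j == mate i)%:R
          + (C - B) * ((mate i == i)%:R + (mate j == j)%:R).
  move=> ij.
  have max0 : (0 : 'I_n) != ord_max by rewrite ord_eqE.
  have [fi|fi] := boolP (mate i == i).
    have := fi; rewrite (eqP fi) eq_sym (negbTE ij) => _.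
    have [fj|fj] := boolP (mate j == j).
      by rewrite (fixmax _ fi) (fixmax _ fj) eqxx in ij.
    rewrite -(fixmax _ fi) in max0.
    rewrite (wgt_fix m_gt3 k2n fi _ max0) 1?eq_sym // (fixmax _ fi) -/C /=.
    by rewrite mulr0 addr0 addr0 mulr1 addrC subrK.
  have [fj|fj] := boolP (mate j == j).
    rewrite -mate_eqC (eqP fj) eq_sym (negbTE ij) wgtC //.
    rewrite -(fixmax _ fj) in max0.
    rewrite (wgt_fix m_gt3 k2n fj _ max0) // (fixmax _ fj) -/C /=.
    by rewrite mulr0 addr0 add0r mulr1 addrC subrK.
  have [->|jm] := eqVneq j (mate i).
    by rewrite (wgt_mate k fi f0) -/A /=; ring.
  rewrite (wgt_far m_gt3 k2n fi fj _ jm f0 f2 n20 n21) 1?eq_sym // -/B /=; ring.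
have row i : \sum_j (wgt i j)%:R = 2 * num_total%:R :> R.
  by rewrite -natr_sum wgt_row // natrM.
have rowE i : \sum_j (wgt i j)%:R = n%:R * B - B + (A - B) * (mate i != i)%:R
     + (C - B) * (n%:R * (mate i == i)%:R + (odd n)%:R - 2 * (mate i == i)%:R).
  pose rhs j := B + (A - B) * (j == mate i)%:R
          + (C - B) * ((mate i == i)%:R + (mate j == j)%:R).
  have -> : \sum_j (wgt i j)%:R = \sum_j (rhs j - rhs i * (j == i)%:R).
    apply: eq_bigr => j _; have [->|ji] := eqVneq j i.
      by rewrite wgt_diag // mulr1 subrr.
    by rewrite mulr0 subr0 form // eq_sym.
  rewrite sumrB -mulr_sumr sum_eq_ind mulr1 /rhs !big_split /= -!mulr_sumr sum_eq_ind.
  have sumc (x : R) : \sum_(j < n) x = n%:R * x by rewrite sumr_const card_ord mulr_natl.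
  rewrite big_split /= !sumc -natr_sum sum_fix.
  rewrite -[(~~ ~~ odd m)]/(odd n); move: (n%:R : R) ((odd n)%:R : R) => x z.
  by rewrite [i == mate i]eq_sym; case: (mate i == i) => /=; ring.
split=> //.
- by rewrite -(row 0) rowE (negbTE f0) /=; ring.
- move=> on; have fm : mate ord_max == ord_max by rewrite mate_fixE on /=.
  by rewrite -(row ord_max) rowE fm on /=; ring.
have -> : (n%:R - (odd n)%:R) * A = (\sum_i wgt i (mate i))%:R.
  rewrite natr_sum -(@sum_fix m) -[n in n%:R - _]card_ord -sum1_card !natr_sum -sumrB.
  rewrite mulr_suml; apply: eq_bigr => i _.
  have [fi|fi] := boolP (mate i == i); first by rewrite (eqP fi) wgt_diag // subrr mul0r.
  by rewrite (wgt_mate k fi f0) subr0 mul1r.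
by rewrite -natrM ler_nat sum_wgt_mate_ge.
Qed.

End Decomposition.

Section Hamiltonian.
Variables (R : realType) (m : nat).
Hypothesis m_gt0 : (0 < m)%N.
Local Notation n := m.+2.
Implicit Types (s g h : 'S_n) (i j p q u w y : 'I_n).

Definition ham_set s : {set edge n} :=
  [set e : edge n | [exists i : 'I_n, val e == [set s i; s (ordS i)]]].

Lemma ham_proof s : is_ham (ham_set s).
Proof. by apply/existsP; exists s. Qed.

Definition ham s : hc n := exist _ (ham_set s) (ham_proof s).

Lemma ham_surj (x : hc n) : exists s, ham s = x.
Proof.
case: x => H hH; have /existsP[s /eqP e] := hH.
by exists s; apply: val_inj; rewrite /= /ham_set e.
Qed.

Lemma edge01_proof : #|[set (0 : 'I_n); 1]| == 2%N.
Proof. by rewrite cards2. Qed.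

(* Junk value {0, 1} when i = j. *)
Definition edge_of i j : edge n :=
  insubd (exist _ [set (0 : 'I_n); 1] edge01_proof : edge n) [set i; j].

Lemma val_edge_of i j : i != j -> val (edge_of i j) = [set i; j].
Proof. by move=> ij; rewrite val_insubd cards2 ij. Qed.

Lemma edge_ofC i j : edge_of i j = edge_of j i.
Proof. by rewrite /edge_of [X in insubd _ X]setUC. Qed.

Lemma set2_eq (T : finType) (a b c d : T) :
  ([set a; b] == [set c; d]) = ((a == c) && (b == d)) || ((a == d) && (b == c)).
Proof.
apply/eqP/idP => [e|/orP[/andP[/eqP-> /eqP->]|/andP[/eqP-> /eqP->]]] //; last by rewrite setUC.
have ha : (a == c) || (a == d) by rewrite -in_set2 -e set21.
have hb : (b == c) || (b == d) by rewrite -in_set2 -e set22.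
have hc : (a == c) || (b == c) by rewrite ![_ == c]eq_sym -in_set2 e set21.
have hd : (a == d) || (b == d) by rewrite ![_ == d]eq_sym -in_set2 e set22.
by move: ha hb hc hd; do 4![case: (_ == _)].
Qed.

Lemma ham_edge_of s i j : i != j -> (edge_of i j \in ham_set s) = adj s i j.
Proof.
move=> ij; rewrite inE val_edge_of // -(permKV s i) -(permKV s j) adjE.
move: ((s^-1)%g i) ((s^-1)%g j) => p q.
apply/existsP/orP => [[a]|].
  by rewrite ordSE set2_eq !(inj_eq (@perm_inj _ s)) => /orP[/andP[/eqP-> /eqP->]|/andP[/eqP-> /eqP->]];
     rewrite eqxx; by [left|right].
case=> /eqP e; [exists p | exists q]; rewrite ordSE e ?eqxx //.
by rewrite setUC eqxx.
Qed.

Lemma eq_ham s s' : ham s = ham s' <-> adj s =2 adj s'.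
Proof.
split => [e i j|e].
  have [->|ij] := eqVneq i j; first by rewrite !adj_irrefl.
  by rewrite -!ham_edge_of // (congr1 val e : ham_set s = ham_set s').
apply: val_inj => /=; apply/setP => A.
have /cards2P[i [j [ij eA]]] := valP A.
have -> : A = edge_of i j by apply: val_inj; rewrite val_edge_of.
by rewrite !ham_edge_of // e.
Qed.

Lemma sum_edges (T : nmodType) (G : edge n -> T) :
  \sum_i \sum_(j | i != j) G (edge_of i j) = (\sum_e G e) *+ 2.
Proof.
rewrite pair_big_dep /= (partition_big (fun z : 'I_n * 'I_n => edge_of z.1 z.2) predT) //=.
rewrite -sumrMnl; apply: eq_bigr => A _.
rewrite (eq_bigr (fun=> G A)); last by move=> z /andP[_ /eqP->].
rewrite sumr_const; congr (_ *+ _).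
have /cards2P[a [b [ab eA]]] := valP A.
rewrite -(_ : #|[set (a, b); (b, a)]| = 2%N); last first.
  by rewrite cards2 xpair_eqE negb_and ab.
apply: eq_card => -[i j]; rewrite !inE unfold_in /= !xpair_eqE.
have [->|ij] /= := eqVneq i j.
  by symmetry; apply/negP => /orP[/andP[/eqP e1 /eqP e2]|/andP[/eqP e1 /eqP e2]]; rewrite -e1 e2 eqxx in ab.
by rewrite -val_eqE /= val_edge_of // eA set2_eq.
Qed.

Lemma sum_ham : exists2 K : nat, (0 < K)%N &
  forall F : hc n -> R, \sum_s F (ham s) = K%:R * \sum_x F x.
Proof.
have hamM s s' g : ham s = ham s' <-> ham (s * g)%g = ham (s' * g)%g.
  rewrite !eq_ham; split=> e i j.
    by rewrite -(permKV g i) -(permKV g j) !adjM.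
  by rewrite -(adjM s g) -(adjM s' g).
exists #|[set s | ham s == ham 1%g]|.
  by apply/card_gt0P; exists 1%g; rewrite inE.
move=> F; rewrite (partition_big ham predT) //= mulr_sumr; apply: eq_bigr => x _.
rewrite (eq_bigr (fun=> F x)); last by move=> s /eqP ->.
rewrite sumr_const mulr_natl; congr (_ *+ _).
have [s1 <-] := ham_surj x.
rewrite -[RHS](card_imset _ (mulIg s1)); apply: eq_card => s; rewrite -[LHS]/(ham s == ham s1).
apply/eqP/imsetP => [e|[s2 + ->]].
  exists (s * s1^-1)%g; last by rewrite mulgKV.
  by rewrite inE; apply/eqP/(hamM _ _ s1); rewrite mulgKV mul1g.
by rewrite inE => /eqP/(hamM _ _ s1) ->; rewrite mul1g.
Qed.

Section LinearFunction.
Variable c : edge n -> R.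

Definition pair_coef i j : R := if i == j then 0 else c (edge_of i j).

Lemma pair_coefC i j : pair_coef i j = pair_coef j i.
Proof. by rewrite /pair_coef eq_sym edge_ofC. Qed.

Lemma pair_coef_diag i : pair_coef i i = 0.
Proof. by rewrite /pair_coef eqxx. Qed.

Lemma lin_ham s : 2 * \sum_e c e * inc R (ham s) e =
  \sum_i \sum_j pair_coef i j * (adj s i j)%:R.
Proof.
rewrite mulr_natl -sum_edges; apply: eq_bigr => i _.
rewrite big_mkcond; apply: eq_bigr => j _; rewrite /pair_coef.
have [->|ij] /= := eqVneq i j; first by rewrite mul0r.
by rewrite /inc /= ham_edge_of.
Qed.

Lemma lin_ham_cycle s : \sum_e c e * inc R (ham s) e = \sum_p pair_coef (s p) (s (p + 1)).
Proof.
have : 2 * \sum_e c e * inc R (ham s) e = 2 * \sum_p pair_coef (s p) (s (p + 1)).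
  rewrite lin_ham.
  under eq_bigr => i _ do under eq_bigr => j _ do rewrite mulr_natr.
  rewrite sum_adj // mulr_sumr; apply: eq_bigr => p _.
  by rewrite [X in _ + X]pair_coefC; ring.
by apply: mulfI; rewrite pnatr_eq0.
Qed.

End LinearFunction.

Lemma one_lin x : \sum_(e : edge n) n%:R^-1 * inc R x e = 1.
Proof.
have [s <-] := ham_surj x; rewrite lin_ham_cycle.
rewrite (eq_bigr (fun=> n%:R^-1)); last first.
  move=> p _; rewrite /pair_coef (inj_eq (@perm_inj _ s)).
  by rewrite add1_neq.
by rewrite sumr_const card_ord -[LHS]mulr_natr mulVf // pnatr_eq0.
Qed.

Lemma avg1_coef (c : edge n -> R) :
  avg (fun x => \sum_e c e * inc R x e) = 1 ->
  \sum_i \sum_j pair_coef c i j = n%:R - 1.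
Proof.
have [K K0 sK] := sum_ham.
have X0 : (0 < #|hc n|)%N by apply/card_gt0P; exists (ham 1%g).
have XK : (#|{perm 'I_n}|%:R = K%:R * #|hc n|%:R :> R).
  by have := sK (fun=> 1); rewrite !sumr_const.
rewrite /avg => /(congr1 (fun z => 2 * (K%:R * (#|hc n|%:R * z)))).
rewrite mulVKf ?pnatr_eq0 -?lt0n // mulr1 -XK -sK mulr_sumr.
under eq_bigr => s _ do rewrite lin_ham.
pose D i j := (\sum_s adj s i j)%N.
have DM g i j : D (g i) (g j) = D i j.
  by rewrite /D (reindex_inj (mulIg g)); apply: eq_bigr => s _; rewrite adjM.
have Dc i j : i != j -> D i j = D 0 1.
  move=> ij; have [g [<- <-]] : exists g, g 0 = i /\ g 1 = j; last exact: DM.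
  exists (tperm 0 i * tperm (tperm 0 i 1%R) j)%g; rewrite !permM; split; last exact: tpermL.
  have hl : tperm 0 i 1 != i.
    by rewrite -[X in _ != X](tpermL 0 i) (inj_eq (@perm_inj _ (tperm 0 i))).
  by rewrite tpermL; apply: tpermD => //; rewrite eq_sym.
have Drow : ((n.-1 * D 0%R 1%R) = 2 * #|{perm 'I_n}|)%N.
  have <- : (\sum_j D 0%R j = 2 * #|{perm 'I_n}|)%N.
    rewrite exchange_big /= (eq_bigr (fun=> 2%N)) => [|s _]; last exact: sum_adj_row.
    by rewrite sum_nat_const mulnC.
  rewrite (bigD1 0%R) //=.
  have -> : D 0%R 0%R = 0%N by apply: big1 => s _; rewrite adj_irrefl.
  rewrite add0n (eq_bigr (fun=> D 0%R 1%R)) => [|j j0]; last by rewrite Dc // eq_sym.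
  by rewrite sum_nat_const cardC1 card_ord.
have D0 : (0 < D 0%R 1%R)%N.
  rewrite lt0n; apply/eqP => e; move: Drow; rewrite e muln0 => /esym/eqP.
  by rewrite muln_eq0 /= -leqn0 leqNgt (_ : 0 < #|{perm 'I_n}|)%N //; apply/card_gt0P; exists 1%g.
rewrite exchange_big /=.
have -> : \sum_i \sum_s \sum_j pair_coef c i j * (adj s i j)%:R =
    (\sum_i \sum_j pair_coef c i j) * (D 0%R 1%R)%:R.
  rewrite mulr_suml; apply: eq_bigr => i _; rewrite exchange_big mulr_suml /=; apply: eq_bigr => j _.
  rewrite -mulr_sumr -natr_sum; have [->|ij] := eqVneq i j; first by rewrite pair_coef_diag !mul0r.
  by rewrite [(\sum_s _)%N](Dc _ _ ij).
rewrite -natrM -Drow natrM => /mulIf ->; last by rewrite pnatr_eq0 -lt0n.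
by rewrite [n in RHS]/= -[in RHS]natr1 addrK.
Qed.

End Hamiltonian.

Section TestPolynomials.
Variables (R : realType) (m k : nat).
Hypotheses (m_gt3 : (3 < m)%N) (k2n : (k.*2 <= m.+2)%N).
Local Notation n := m.+2.
Implicit Types (s g h : 'S_n) (i j p q u w y : 'I_n).
Local Notation sat := (@sat m k).
Local Notation num_sat_adj := (@num_sat_adj m k).
Local Notation wgt := (@wgt m k).
Local Notation mate := (@mate m).

Let m_gt0 : (0 < m)%N. Proof. lia. Qed.

Definition pair_fst (t : 'I_k) : 'I_n := inord t.*2.

Lemma val_pair_fst t : pair_fst t = t.*2 :> nat.
Proof. by rewrite inordK //; have := ltn_ord t; lia. Qed.

Lemma satE s : sat s = [forall t : 'I_k, adj s (pair_fst t) (mate (pair_fst t))].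
Proof.
apply/forallP/forallP => [hs t|ht i].
  by apply: (implyP (hs _)); rewrite val_pair_fst; have := ltn_ord t; lia.
apply/implyP => hi; have hk : (i./2 < k)%N by lia.
have := ht (Ordinal hk).
have [oi|ei] := boolP (odd i).
  have -> : pair_fst (Ordinal hk) = mate i.
    by apply: val_inj; rewrite /= val_mate val_pair_fst /= oi; lia.
  by rewrite mateK adjC.
by rewrite (_ : pair_fst _ = i) //; apply: val_inj; rewrite /= val_pair_fst /=; lia.
Qed.

Definition test_poly g : {mpoly R[#|edge n|]} :=
  'X_[\sum_(t < k) U_(enum_rank (edge_of (g (pair_fst t)) (g (mate (pair_fst t)))))].

Lemma msize_test_poly g : (msize (test_poly g) <= k.+1)%N.
Proof.
rewrite msizeX mdeg_sum (eq_bigr (fun=> 1%N)) => [|t _]; last by rewrite mdeg1.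
by rewrite sum_nat_const card_ord muln1.
Qed.

Lemma test_polyE g s : (test_poly g).@[Defs.coord R (ham s)] = (sat (s * g^-1)%g)%:R.
Proof.
rewrite /test_poly (big_morph _ (@mpolyXD _ _) (@mpolyX0 _ _)) rmorph_prod /=.
under eq_bigr => t _.
  rewrite mevalXU /Defs.coord enum_rankK /inc /= ham_edge_of; last first.
    rewrite (inj_eq (@perm_inj _ g)) eq_sym (@mate_neq m k) // val_pair_fst.
    by have := ltn_ord t; lia.
  rewrite -(adjM s g^-1)%g !permK.
  over.
rewrite satE /=; case: forallP => [h|/forallP/forallPn[t ht]].
  by rewrite big1 // => t _; rewrite h.
by rewrite (bigD1 t) //= (negbTE ht) mul0r.
Qed.

Lemma Pset_num_sat_adj (c : edge n -> R) g :
  Pset k (fun x => \sum_e c e * inc R x e) ->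
  0 <= \sum_i \sum_j pair_coef c (g i) (g j) * (num_sat_adj i j)%:R.
Proof.
case=> _ _ /(_ _ (msize_test_poly g)); rewrite /qf /avg.
have [K K0 sK] := @sum_ham R m.
rewrite pmulr_rge0; last first.
  by rewrite invr_gt0 ltr0n; apply/card_gt0P; exists (ham 1%g).
have K0' : 0 < K%:R :> R by rewrite ltr0n.
rewrite -(pmulr_rge0 _ K0') -sK -(pmulr_rge0 _ (@ltr0Sn R 1)) mulr_sumr.
rewrite (reindex_inj (mulIg g)) /=.
under eq_bigr => s _.
  rewrite test_polyE mulgK mulrA lin_ham.
  rewrite -[X in _ * X](_ : (sat s)%:R = _); last by case: (sat s); rewrite ?expr1n ?expr0n.
  rewrite (reindex_inj (@perm_inj _ g)) mulr_suml /=.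
  under eq_bigr => i _.
    rewrite (reindex_inj (@perm_inj _ g)) mulr_suml /=.
    under eq_bigr => j _.
      rewrite adjM -mulrA -natrM mulnC mulnb.
      over.
    over.
  over.
rewrite exchange_big /=; congr (0 <= _); apply: eq_bigr => i _.
rewrite exchange_big /=; apply: eq_bigr => j _.
by rewrite -mulr_sumr -natr_sum.
Qed.

Lemma Pset_wgt (c : edge n -> R) g :
  Pset k (fun x => \sum_e c e * inc R x e) ->
  0 <= \sum_i \sum_j pair_coef c (g i) (g j) * (wgt i j)%:R.
Proof.
move=> Pf.
have -> : \sum_i \sum_j pair_coef c (g i) (g j) * (wgt i j)%:R =
  \sum_(h in mate_cent m) \sum_i \sum_j
     pair_coef c ((h^-1 * g)%g i) ((h^-1 * g)%g j) * (num_sat_adj i j)%:R.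
  rewrite [RHS](eq_bigr (fun h : 'S_n =>
      \sum_i \sum_j pair_coef c (g i) (g j) * (num_sat_adj (h i) (h j))%:R)).
    rewrite [RHS]exchange_big /=; apply: eq_bigr => i _.
    rewrite [RHS]exchange_big /=; apply: eq_bigr => j _.
    by rewrite natr_sum mulr_sumr.
  move=> h _; rewrite (reindex_inj (@perm_inj _ h)); apply: eq_bigr => i _.
  rewrite (reindex_inj (@perm_inj _ h)); apply: eq_bigr => j _.
  by rewrite !permM !permK.
by apply: sumr_ge0 => h _; apply: Pset_num_sat_adj.
Qed.

Lemma mate_succ i : mate i != i -> mate i = i + 1 \/ i = mate i + 1.
Proof.
move=> fi.
suff : (mate i == i + 1) || (i == mate i + 1) by case/orP => /eqP; auto.
move: fi; rewrite !ord_eqE !val_add1 val_mate.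
have := ltn_ord i.
by case: (boolP (odd i)) => h1; repeat case: ifP => ?; lia.
Qed.

Lemma Pset_rotations (c : edge n -> R) s (A B C : R) :
  Pset k (fun x => \sum_e c e * inc R x e) ->
  (forall i j, i != j -> (wgt i j)%:R =
        B + (A - B) * (j == mate i)%:R
          + (C - B) * ((mate i == i)%:R + (mate j == j)%:R)) ->
  0 <= n%:R * B * (n%:R - 1)
       + (A - B) * ((n%:R - (odd n)%:R) * \sum_e c e * inc R (ham s) e)
       + 2 * (C - B) * (odd n)%:R * (n%:R - 1).
Proof.
move=> Pf form.
have c1 : \sum_i \sum_j pair_coef c i j = n%:R - 1.
  by apply: avg1_coef => //; case: Pf.
pose G t i j := pair_coef c (s (i + t)) (s (j + t)).
have G1 i j : \sum_t G t i j = \sum_p pair_coef c (s p) (s (p + (j - i))).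
  rewrite [RHS](reindex_inj (addrI i)); apply: eq_bigr => t _.
  by rewrite /G; congr (pair_coef c _ (s _)); rewrite [RHS]addrC addrA subrK.
have G2 t : \sum_i \sum_j G t i j = n%:R - 1.
  rewrite -c1 [RHS](reindex_inj (inj_comp (@perm_inj _ s) (addIr t))); apply: eq_bigr => i _.
  by rewrite [RHS](reindex_inj (inj_comp (@perm_inj _ s) (addIr t))).
have G3 i : \sum_t \sum_j G t i j = n%:R - 1.
  rewrite -c1 [RHS](reindex_inj (inj_comp (@perm_inj _ s) (addrI i))); apply: eq_bigr => t _.
  by rewrite [RHS](reindex_inj (inj_comp (@perm_inj _ s) (addIr t))).
have G4 j : \sum_t \sum_i G t i j = n%:R - 1.
  rewrite -(G3 j); apply: eq_bigr => t _; apply: eq_bigr => i _.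
  by rewrite /G pair_coefC.
have G5 i : \sum_t G t i (mate i) = (mate i != i)%:R * \sum_e c e * inc R (ham s) e.
  have [fi|fi] := eqVneq (mate i) i.
    by rewrite mul0r big1 // => t _; rewrite /G fi pair_coef_diag.
  rewrite mul1r lin_ham_cycle //.
  case: (mate_succ fi) => e.
    by rewrite G1 e addrAC subrr add0r.
  rewrite (eq_bigr (fun t => G t (mate i) i)) => [|t _]; last by rewrite /G pair_coefC.
  by rewrite G1 {1}e addrAC subrr add0r.
have -> : n%:R * B * (n%:R - 1)
       + (A - B) * ((n%:R - (odd n)%:R) * \sum_e c e * inc R (ham s) e)
       + 2 * (C - B) * (odd n)%:R * (n%:R - 1) =
   \sum_t \sum_i \sum_j pair_coef c ((rot_perm t * s)%g i) ((rot_perm t * s)%g j) * (wgt i j)%:R.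
  have -> : \sum_t \sum_i \sum_j pair_coef c ((rot_perm t * s)%g i) ((rot_perm t * s)%g j) * (wgt i j)%:R
    = \sum_t \sum_i \sum_j (B * G t i j + (A - B) * (G t i j * (j == mate i)%:R)
        + (C - B) * (G t i j * (mate i == i)%:R + G t i j * (mate j == j)%:R)).
    apply: eq_bigr => t _; apply: eq_bigr => i _; apply: eq_bigr => j _.
    rewrite !permM ![rot_perm t _]permE -/(G t i j).
    have [->|ij] := eqVneq i j; last by rewrite form //; ring.
    by rewrite /G pair_coef_diag; ring.
  have sumfix : \sum_i (mate i == i)%:R = (odd n)%:R :> R by rewrite -natr_sum sum_fix.
  have sumnfix : \sum_i (mate i != i)%:R = n%:R - (odd n)%:R :> R.
    rewrite -sumfix -[n in n%:R]card_ord -sum1_card natr_sum -sumrB.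
    by apply: eq_bigr => i _; case: (mate i == i); rewrite ?subrr ?subr0.
  have S1 : \sum_t \sum_i \sum_j B * G t i j = n%:R * B * (n%:R - 1).
    under eq_bigr => t _.
      under eq_bigr => i _ do rewrite -mulr_sumr.
      rewrite -mulr_sumr G2.
      over.
    by rewrite sumr_const card_ord -mulrA -[LHS]mulr_natl.
  have S2 : \sum_t \sum_i \sum_j (A - B) * (G t i j * (j == mate i)%:R) =
     (A - B) * ((n%:R - (odd n)%:R) * \sum_e c e * inc R (ham s) e).
    rewrite -sumnfix mulr_suml mulr_sumr exchange_big /=; apply: eq_bigr => i _.
    rewrite -G5 mulr_sumr; apply: eq_bigr => t _.
    rewrite -mulr_sumr; congr (_ * _).
    by rewrite (bigD1 (mate i)) //= eqxx mulr1 big1 ?addr0 // => j /negbTE ->; rewrite mulr0.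
  have S3 : \sum_t \sum_i \sum_j (C - B) * (G t i j * (mate i == i)%:R + G t i j * (mate j == j)%:R)
     = 2 * (C - B) * (odd n)%:R * (n%:R - 1).
    have E1 : \sum_t \sum_i \sum_j G t i j * (mate i == i)%:R = (odd n)%:R * (n%:R - 1).
      rewrite exchange_big -sumfix mulr_suml; apply: eq_bigr => i _ /=.
      by rewrite -(G3 i) mulr_sumr; apply: eq_bigr => t _; rewrite mulrC mulr_suml.
    have E2 : \sum_t \sum_i \sum_j G t i j * (mate j == j)%:R = (odd n)%:R * (n%:R - 1).
      under eq_bigr => t _ do rewrite exchange_big /=.
      rewrite exchange_big -sumfix mulr_suml; apply: eq_bigr => j _ /=.
      by rewrite -(G4 j) mulr_sumr; apply: eq_bigr => t _; rewrite mulrC mulr_suml.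
    transitivity ((C - B) * ((odd n)%:R * (n%:R - 1) + (odd n)%:R * (n%:R - 1))); last by ring.
    rewrite -{1}E1 -E2 -big_split mulr_sumr; apply: eq_bigr => t _ /=.
    rewrite -big_split mulr_sumr; apply: eq_bigr => i _ /=.
    by rewrite -big_split mulr_sumr.
  rewrite -S1 -S2 -S3 -!big_split; apply: eq_bigr => t _ /=.
  rewrite -!big_split; apply: eq_bigr => i _ /=.
  by rewrite -!big_split.
by apply: sumr_ge0 => t _; apply: Pset_wgt.
Qed.

End TestPolynomials.

Lemma deviation_bound_even (R : realFieldType) (N k A B T F : R) :
  9 <= N -> 1 <= k -> 0 < T -> 2 * k <= N ->
  0 <= N * B * (N - 1) + (A - B) * (N * F) ->
  N * B - B + (A - B) = 2 * T ->
  T * (2 * k * (N - k - 1) + 2 * (N - 2 * k)) <= (N - k - 1) * (N * A) ->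
  1 - (N / k + 10 / N) <= F.
Proof.
move=> N9 k1 T0 kN h1 h2 h4.
have N0 : 0 < N by lra.
have k0 : 0 < k by lra.
rewrite leNgt; apply/negP => hF.
set G := 1 - F; set P := N - k - 1.
have P0 : 0 < P by rewrite /P; lra.
have hG : N ^+ 2 + 10 * k < N * k * G.
  have -> : N ^+ 2 + 10 * k = N * k * (N / k + 10 / N) by field; rewrite !gt_eqF.
  by rewrite ltr_pM2l ?mulr_gt0 // /G; lra.
pose D := (N - 1) * A - 2 * T.
pose E := N ^+ 2 - 3 * N + 3 - k * (N - 1).
have E0 : N ^+ 2 <= 10 * E by rewrite /E; nra.
have hD : 2 * T * k * E <= P * N * D.
  have : 0 <= (N - 1) * (P * (N * A) - T * (2 * k * P + 2 * (N - 2 * k))).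
    by rewrite mulr_ge0 //; rewrite /P; lra.
  by rewrite /D /E /P; lra.
have hDG : D * G <= 2 * T * (N - 2).
  have : 0 <= (N - 1) * B + (A - B) * F.
    by rewrite -(pmulr_rge0 _ N0); move: h1; congr (_ <= _); ring.
  move=> h; have : 0 <= (N - 2) * ((N - 1) * B + (A - B) * F) by rewrite mulr_ge0 //; lra.
  have -> : (N - 2) * ((N - 1) * B + (A - B) * F) =
     (N - 1) * ((N - 2) * B) + ((N - 2) * A - (N - 2) * B) * F by ring.
  have -> : (N - 2) * B = 2 * T - A by rewrite -h2; ring.
  by rewrite /D /G; lra.
have G0 : 0 < G.
  by rewrite -(pmulr_rgt0 _ (mulr_gt0 N0 k0)); apply: lt_trans hG; nra.
have e1 : 2 * T * (k * E * G) <= 2 * T * ((N - 2) * P * N).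
  have : 2 * T * k * E * G <= P * N * D * G by rewrite ler_pM2r.
  have : P * N * (D * G) <= P * N * (2 * T * (N - 2)) by rewrite ler_pM2l // mulr_gt0.
  lra.
rewrite ler_pM2l ?mulr_gt0 // in e1.
have e2 : E * (N ^+ 2 + 10 * k) < E * (N * k * G) by rewrite ltr_pM2l //; nra.
have e3 : N * (k * E * G) <= N * ((N - 2) * P * N) by rewrite ler_pM2l.
have e4 : k * N ^+ 2 <= k * (10 * E) by rewrite ler_pM2l.
have e5 : 0 <= N ^+ 2 by rewrite sqr_ge0.
rewrite /E /P in e2 e3 e4 *; lra.
Qed.

Lemma deviation_bound_odd (R : realFieldType) (N k A B C T F : R) :
  9 <= N -> 1 <= k -> 0 < T -> 2 * k <= N - 1 ->
  0 <= N * B * (N - 1) + (A - B) * ((N - 1) * F) + 2 * (C - B) * (N - 1) ->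
  N * B - B + (A - B) + (C - B) = 2 * T ->
  (N - 1) * C = 2 * T ->
  T * (2 * k * (N - k - 1) + 2 * (N - 1 - 2 * k)) <= (N - k - 1) * ((N - 1) * A) ->
  1 - (N / k + 10 / N) <= F.
Proof.
move=> N9 k1 T0 kN h1 h2 h3 h4.
have N0 : 0 < N by lra.
have k0 : 0 < k by lra.
have N1 : 0 < N - 1 by lra.
rewrite leNgt; apply/negP => hF.
set G := 1 - F; set P := N - k - 1.
have P0 : 0 < P - 1 by rewrite /P; lra.
have hG : N ^+ 2 + 10 * k < N * k * G.
  have -> : N ^+ 2 + 10 * k = N * k * (N / k + 10 / N) by field; rewrite !gt_eqF.
  by rewrite ltr_pM2l ?mulr_gt0 // /G; lra.
pose D := A - B.
have hD : (N - 2) * (2 * T * k * (P - 1)) <= (N - 3) * (N - 1) * P * D.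
  have -> : (N - 3) * (N - 1) * P * D = (N - 2) * (P * ((N - 1) * A - 2 * T)).
    transitivity (P * (N - 1) * ((N - 3) * A - (N - 3) * B)); first by rewrite /D; ring.
    have -> : (N - 3) * B = 2 * T - A - C by rewrite -h2; ring.
    transitivity (P * ((N - 1) * ((N - 2) * A - 2 * T) + (N - 1) * C)); first by ring.
    by rewrite h3; ring.
  rewrite ler_pM2l; last by lra.
  by move: h4; rewrite -/P => h4; rewrite /P in h4 *; lra.
have hDG : (N - 1) * (D * G) <= 2 * T * N.
  have : 0 <= (N - 2) * B + 2 * C + (A - B) * F.
    by rewrite -(pmulr_rge0 _ N1); move: h1; congr (_ <= _); ring.
  move=> h; have : D * G <= 2 * T + C by rewrite -h2 /D /G; lra.
  rewrite -(ler_pM2l N1) => /le_trans; apply.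
  by rewrite mulrDr h3; lra.
have G0 : 0 < G.
  by rewrite -(pmulr_rgt0 _ (mulr_gt0 N0 k0)); apply: lt_trans hG; nra.
have e1 : 2 * T * ((N - 2) * (k * (P - 1) * G)) <= 2 * T * ((N - 3) * P * N).
  have : (N - 2) * (2 * T * k * (P - 1)) * G <= (N - 3) * (N - 1) * P * D * G by rewrite ler_pM2r.
  have : (N - 3) * P * ((N - 1) * (D * G)) <= (N - 3) * P * (2 * T * N).
    by rewrite ler_pM2l // mulr_gt0 //; lra.
  lra.
rewrite ler_pM2l ?mulr_gt0 // in e1.
have e2 : (N - 2) * (P - 1) * (N ^+ 2 + 10 * k) < (N - 2) * (P - 1) * (N * k * G).
  by rewrite ltr_pM2l // mulr_gt0 //; lra.
have e3 : N * ((N - 2) * (k * (P - 1) * G)) <= N * ((N - 3) * P * N) by rewrite ler_pM2l.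
have e4 : k * N ^+ 2 <= k * (10 * ((N - 2) * (P - 1))) by rewrite ler_pM2l // /P; nra.
have e5 : 0 <= N ^+ 2 by rewrite sqr_ge0.
rewrite /P in e2 e3 e4 *; lra.
Qed.

Lemma Pset_lower_bound (R : realType) (m k : nat) (f : hc m.+2 -> R) (x : hc m.+2) :
  (9 <= m.+2)%N -> (0 < k)%N -> (k.*2 <= m.+2)%N -> Pset k f ->
  1 - (m.+2%:R / k%:R + 10 / m.+2%:R) <= f x.
Proof.
move=> n9 k0 kn Pf; have m3 : (3 < m)%N by lia.
have [[c fc] _ _] := Pf.
have {}fc : f = fun x => \sum_e c e * inc R x e by apply: funext.
rewrite {f}fc in Pf *.
have [s <-] := ham_surj x.
have [A [B [C [form h2 h3 h4]]]] := wgt_decomp R m3 kn.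
have h1 := Pset_rotations m3 kn s Pf form.
have T0 : 0 < (num_total m k)%:R :> R by rewrite ltr0n num_total_gt0.
have n9' : 9 <= m.+2%:R :> R by rewrite ler_nat.
have k1 : 1 <= k%:R :> R by rewrite ler1n.
have Enk : (m.+2 - k - 1)%:R = m.+2%:R - k%:R - 1 :> R by rewrite !natrB //; lia.
have Ek : (k.*2)%:R = 2 * k%:R :> R by rewrite -muln2 natrM mulrC.
move: T0 h1 h2 h3 h4; move: (num_total m k) => T T0; rewrite natrM natrD !natrM Enk Ek.
have [on|en] := boolP (odd m.+2) => /= h1 h2 h3 h4.
  have kn1 : (k.*2 <= m.+2 - 1)%N by lia.
  rewrite !natrB ?Ek in h4; try lia.
  apply: (deviation_bound_odd (A := A) (B := B) (C := C) n9' k1 T0) => //.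
  - by rewrite -Ek lerBrDr natr1 ler_nat; lia.
  - by rewrite mulr1 in h1.
  - by rewrite mulr1 in h2.
  - by rewrite -h3.
rewrite !subr0 !mulr0 !mul0r !addr0 in h1 h2 h4.
rewrite subn0 natrB // Ek in h4.
apply: (deviation_bound_even (A := A) (B := B) n9' k1 T0) => //.
- by rewrite -Ek ler_nat.
Qed.

Theorem theorem1 (R : realType) (n k : nat) :
  (9 <= n)%N -> (1 <= k <= n./2)%N ->
  exists a : R, exists alpha : R,
    [/\ a = n%:R / k%:R + alpha, `|alpha| <= 10 / n%:R,
        subsetS (shiftS (@Qset R n) (@one_fn R n)) (shiftS (@Pset R n k) (@one_fn R n)) &
        subsetS (shiftS (@Pset R n k) (@one_fn R n))
                (scaleS a (shiftS (@Qset R n) (@one_fn R n)))].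
Proof.
case: n => [|[|m]] // n9 /andP[k1 kn].
have m0 : (0 < m)%N by lia.
have X0 : (0 < #|hc m.+2|)%N by apply/card_gt0P; exists (ham 1%g).
exists (m.+2%:R / k%:R + 10 / m.+2%:R), (10 / m.+2%:R); split=> //.
- by rewrite ger0_norm // divr_ge0.
- move=> _ [f [lf f0 f1] ->]; exists f => //; split=> // h _.
  rewrite /qf /avg mulr_ge0 ?invr_ge0 ?ler0n //.
  by apply: sumr_ge0 => x _; rewrite mulr_ge0 ?sqr_ge0.
move=> _ [f Pf ->]; set a := _ + _.
have a0 : 0 < a by rewrite addr_gt0 // divr_gt0 // ltr0n.
have [[c fc] f1 _] := Pf.
pose f' x := 1 + (f x - 1) / a.
exists (fun x => f' x - one_fn R x); last first.
  by apply: funext => x; rewrite /f' /one_fn [1 + _]addrC addrK mulrC divfK // gt_eqF.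
exists f' => //; split.
- exists (fun e => m.+2%:R^-1 * (1 - a^-1) + c e / a) => x.
  rewrite /f' fc -{1 2}(one_lin R m0 x) mulrBl mulr_suml mulr_suml -sumrB -big_split /=.
  by apply: eq_bigr => e _; ring.
- move=> x; have fx : 1 - a <= f x by apply: Pset_lower_bound => //; lia.
  by rewrite /f' -(pmulr_rge0 _ a0) mulrDr mulrCA divff ?gt_eqF // !mulr1; lra.
move: f1; rewrite /avg /f' => f1.
rewrite big_split /= -mulr_suml sumrB sumr_const.
have X0' : #|hc m.+2|%:R != 0 :> R by rewrite pnatr_eq0 -lt0n.
have -> : \sum_x f x = #|hc m.+2|%:R.
  by have := congr1 ( *%R #|hc m.+2|%:R) f1; rewrite mulVKf // mulr1.
by rewrite subrr mul0r addr0 mulVf.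
Qed.
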